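(* Let $N,n,d_x,d_y\ge 1$ be integers, let $r_x,r_y>0$, and let $(\mathbf f_1,\mathbf g_1),\dots,(\mathbf f_N,\mathbf g_N)$ be fixed pairs of vectors with $\mathbf f_i\in\mathbb R^{d_x}$, $\mathbf g_i\in\mathbb R^{d_y}$ (the network outputs on the training set). Let $\Sigma_{xx},\Sigma_{yy},\Sigma_{xy}$ be the regularized full-sample covariance matrices, $\hat\Sigma_{xx},\hat\Sigma_{yy},\hat\Sigma_{xy}$ their random minibatch estimates, and $\mathbf A,\mathbf B,\hat{\mathbf A},\hat{\mathbf B}$ the associated block matrices, all as defined in the context. Assume: (A1) the samples used to form $\hat\Sigma_{xx}$, $\hat\Sigma_{yy}$ and $\hat\Sigma_{xy}$ are chosen independently from each other, each consisting of $n$ examples (for $\hat\Sigma_{xx}$ and $\hat\Sigma_{yy}$) or $n$ example pairs (for $\hat\Sigma_{xy}$) drawn uniformly at random with replacement from the training set; (A2) there is a constant $B$ such that $\max(\|\mathbf f_i\|^2,\|\mathbf g_i\|^2)\le B$ for all $i=1,\dots,N$; and assume that there are $\gamma_x>0$ and $\gamma_y>0$ such that, for every realization of the sampling, $\hat\Sigma_{xx}\succeq\gamma_x\mathbf I$ and $\hat\Sigma_{yy}\succeq\gamma_y\mathbf I$. Then $$\mathbb E\,\bigl\|\hat{\mathbf A}^{-1}\hat{\mathbf B}-\mathbf A^{-1}\mathbf B\bigr\|\le\max\{e_1,e_2\},$$ where the expectation is over the random selection of training samples described in (A1), $\|\cdot\|$ is the spectral norm, and $$e_1=\frac{B}{\gamma_x^2}\left(\sqrt{\frac{2B^2\log(2d_x)}{n}}+\frac{2B\log(2d_x)}{3n}\right)+\frac1{\gamma_x}\left(\sqrt{\frac{2B^2\log(d_x+d_y)}{n}}+\frac{2B\log(d_x+d_y)}{3n}\right),$$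 $$e_2=\frac{B}{\gamma_y^2}\left(\sqrt{\frac{2B^2\log(2d_y)}{n}}+\frac{2B\log(2d_y)}{3n}\right)+\frac1{\gamma_y}\left(\sqrt{\frac{2B^2\log(d_x+d_y)}{n}}+\frac{2B\log(d_x+d_y)}{3n}\right).$$
   Context: Full-sample matrices: $$\Sigma_{xx}=\frac1N\sum_{i=1}^N\mathbf f_i\mathbf f_i^\top+r_x\mathbf I,\qquad \Sigma_{yy}=\frac1N\sum_{i=1}^N\mathbf g_i\mathbf g_i^\top+r_y\mathbf I,\qquad \Sigma_{xy}=\frac1N\sum_{i=1}^N\mathbf f_i\mathbf g_i^\top .$$ Minibatch estimates: let $I_1,\dots,I_n$, $J_1,\dots,J_n$, $K_1,\dots,K_n$ be the random indices in $\{1,\dots,N\}$ selected for the three estimates (under (A1) these are $3n$ independent uniformly distributed indices). Then $$\hat\Sigma_{xx}=\frac1n\sum_{k=1}^n\mathbf f_{I_k}\mathbf f_{I_k}^\top+r_x\mathbf I,\qquad \hat\Sigma_{yy}=\frac1n\sum_{k=1}^n\mathbf g_{J_k}\mathbf g_{J_k}^\top+r_y\mathbf I,\qquad \hat\Sigma_{xy}=\frac1n\sum_{k=1}^n\mathbf f_{K_k}\mathbf g_{K_k}^\top .$$ Block matrices, of size $(d_x+d_y)\times(d_x+d_y)$: $$\mathbf A=\begin{pmatrix}\Sigma_{xx}&\mathbf 0\\ \mathbf 0&\Sigma_{yy}\end{pmatrix},\quad \mathbf B=\begin{pmatrix}\mathbf 0&\Sigma_{xy}\\ \Sigma_{xy}^\top&\mathbf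 0\end{pmatrix},\quad \hat{\mathbf A}=\begin{pmatrix}\hat\Sigma_{xx}&\mathbf 0\\ \mathbf 0&\hat\Sigma_{yy}\end{pmatrix},\quad \hat{\mathbf B}=\begin{pmatrix}\mathbf 0&\hat\Sigma_{xy}\\ \hat\Sigma_{xy}^\top&\mathbf 0\end{pmatrix}.$$ The bold letter $\mathbf B$ denotes the block matrix, while the non-bold $B$ denotes the scalar bound in (A2). For vectors, $\|\cdot\|$ is the Euclidean norm; for matrices, the spectral norm. $\mathbf M\succeq\gamma\mathbf I$ means that $\mathbf M-\gamma\mathbf I$ is positive semidefinite. $\log$ is the natural logarithm. *)

(* Defs.v *)
From HB Require Import structures.
From mathcomp Require Import all_boot all_order all_algebra.
From mathcomp Require Import all_classical all_reals all_analysis.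

Set Implicit Arguments.
Unset Strict Implicit.
Unset Printing Implicit Defensive.

Import Order.TTheory GRing.Theory Num.Theory.
Import numFieldNormedType.Exports.

Local Open Scope classical_set_scope.
Local Open Scope ring_scope.

(* The norm that MathComp-Analysis puts on matrices is the entrywise maximum,
   hence a separate Euclidean norm. *)
Definition norm2 (R : realType) (p : nat) (x : 'cV[R]_p) : R :=
  Num.sqrt (\sum_(i < p) x i ord0 ^+ 2).

(* The operator norm induced by [norm2]; the set is nonempty and bounded, so
   [sup] is its genuine supremum. *)
Definition spectral_norm (R : realType) (p q : nat) (M : 'M[R]_(p, q)) : R :=
  sup [set norm2 (M *m x) | x in [set x : 'cV[R]_q | norm2 x <= 1]].

Definition psd (R : realType) (p : nat) (M : 'M[R]_p) : Prop :=
  M^T = M /\ forall x : 'cV[R]_p, 0 <= (x^T *m M *m x) ord0 ord0.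

(* With [m] the training set size these are the full-sample matrices; the
   minibatch estimates are obtained by composing [u] and [v] with the sampled
   indices. *)
Definition reg_cov (R : realType) (m p : nat) (u : 'I_m -> 'cV[R]_p) (r : R) :
    'M[R]_p :=
  m%:R^-1 *: (\sum_(i < m) u i *m (u i)^T) + r%:M.

Definition cross_cov (R : realType) (m p q : nat)
    (u : 'I_m -> 'cV[R]_p) (v : 'I_m -> 'cV[R]_q) : 'M[R]_(p, q) :=
  m%:R^-1 *: (\sum_(i < m) u i *m (v i)^T).

Definition diag_block (R : realType) (p q : nat)
    (Sxx : 'M[R]_p) (Syy : 'M[R]_q) : 'M[R]_(p + q) :=
  block_mx Sxx 0 0 Syy.

Definition offdiag_block (R : realType) (p q : nat) (Sxy : 'M[R]_(p, q)) :
    'M[R]_(p + q) :=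
  block_mx 0 Sxy Sxy^T 0.

(* Every subset of the finite type [V] is taken to be measurable. *)
Definition discrete_rv (d : measure_display) (T : measurableType d)
    (V : finType) (X : T -> V) : Prop :=
  forall E : set V, measurable (X @^-1` E).

Definition uniform_rv (R : realType) (d : measure_display)
    (T : measurableType d) (P : probability T R) (V : finType) (X : T -> V) :
    Prop :=
  forall v : V, P (X @^-1` [set v]) = (#|V|%:R^-1)%:E.

Definition mutually_independent (R : realType) (d : measure_display)
    (T : measurableType d) (P : probability T R) (S V : finType)
    (X : S -> T -> V) : Prop :=
  forall (s : {set S}) (E : S -> set V),
    P (\bigcap_(i in [set` s]) (X i @^-1` E i)) =
    (\prod_(i in s) P (X i @^-1` E i))%E.

Definition all_indices (T : Type) (N n : nat) (I J K : 'I_n -> T -> 'I_N)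
    (s : 'I_n + 'I_n + 'I_n) : T -> 'I_N :=
  match s with
  | inl (inl k) => I k
  | inl (inr k) => J k
  | inr k => K k
  end.

(* Independence of the 3n indices expresses both that the three samples are
   independent of each other and that each one is drawn with replacement. *)
Definition uniform_sampling (R : realType) (d : measure_display)
    (T : measurableType d) (P : probability T R) (N n : nat)
    (I J K : 'I_n -> T -> 'I_N) : Prop :=
  [/\ forall s, discrete_rv (all_indices I J K s),
      forall s, uniform_rv P (all_indices I J K s)
    & mutually_independent P (all_indices I J K)].

(* Matrix Bernstein bound on the expected norm of an average of [n] terms, with
   dimension factor [D]. *)
Definition bernstein_bound (R : realType) (B : R) (n D : nat) : R :=
  Num.sqrt (2 * B ^+ 2 * ln D%:R / n%:R) + 2 * B * ln D%:R / (3 * n%:R).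

(* Main.v *)
(* No matrix concentration inequality is needed: the summands have rank one, so
   the Frobenius norm, for which the mean square deviation of an average of [n]
   independent draws is exactly the variance over [n], costs no dimension factor.
   The error is block off-diagonal, its blocks being bounded by
   c_x |D_xy| + a_x |D_xx| and c_y |D_xy| + a_y |D_yy| with c = 1/gamma and
   a = B/gamma^2.  If gamma_x <= gamma_y, their maximum is at most
   a_x sqrt(|D_xx|^2 + |D_yy|^2) + c_x |D_xy|, and Jensen's inequality with
   E|D|^2 <= B^2/n bounds the mean by (sqrt 2 a_x + c_x) B/sqrt n.  This is at
   most e_1 when d_x >= 2; when d_x = 1, the variance of D_xx is at most B^2/4
   and sqrt 2 improves to sqrt(5/4), which suffices since 5/4 <= 2 ln 2. *)
Require Import Defs.
From HB Require Import structures.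
From mathcomp Require Import all_boot all_order all_algebra.
From mathcomp Require Import all_classical all_reals all_analysis.
From mathcomp Require Import ring lra.

Set Implicit Arguments.
Unset Strict Implicit.
Unset Printing Implicit Defensive.

Import Order.TTheory GRing.Theory Num.Theory.
Import numFieldNormedType.Exports.

Local Open Scope classical_set_scope.
Local Open Scope ring_scope.

(** * Uniform averages over finite types *)

Section Mean.
Variable R : realType.

(** Serves both as the average over the training set and as the expectation over all outcomes of the
    sampling. *)
Definition mean (V : finType) (F : V -> R) : R := #|V|%:R^-1 * \sum_v F v.

Lemma eq_mean (V : finType) (F G : V -> R) : F =1 G -> mean F = mean G.
Proof. by move=> FG; congr (_ * _); apply: eq_bigr. Qed.

Lemma le_mean (V : finType) (F G : V -> R) :
  (forall v, F v <= G v) -> mean F <= mean G.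
Proof. by move=> FG; rewrite ler_wpM2l ?invr_ge0 ?ler0n// ler_sum. Qed.

Lemma mean_ge0 (V : finType) (F : V -> R) : (forall v, 0 <= F v) -> 0 <= mean F.
Proof. by move=> F0; rewrite mulr_ge0 ?invr_ge0 ?ler0n// sumr_ge0. Qed.

Lemma meanD (V : finType) (F G : V -> R) :
  mean (fun v => F v + G v) = mean F + mean G.
Proof. by rewrite /mean big_split mulrDr. Qed.

Lemma meanZ (V : finType) (c : R) (F : V -> R) :
  mean (fun v => c * F v) = c * mean F.
Proof. by rewrite /mean -mulr_sumr mulrCA. Qed.

Lemma mean_sum (V E : finType) (F : E -> V -> R) :
  mean (fun v => \sum_e F e v) = \sum_e mean (F e).
Proof. by rewrite /mean exchange_big mulr_sumr. Qed.

Lemma mean_cst (V : finType) (c : R) : (0 < #|V|)%N -> mean (fun _ : V => c) = c.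
Proof.
by move=> V0; rewrite /mean sumr_const -[c *+ _]mulr_natl mulKf// pnatr_eq0 -lt0n.
Qed.

Lemma mean_sqr_sub (V : finType) (F : V -> R) : (0 < #|V|)%N ->
  mean (fun v => (F v - mean F) ^+ 2) = mean (fun v => F v ^+ 2) - mean F ^+ 2.
Proof.
move=> V0; set m := mean F.
rewrite (eq_mean (G := fun v => F v ^+ 2 + (- (2 * m) * F v + m ^+ 2))); last first.
  by move=> v; ring.
by rewrite 2!meanD meanZ mean_cst// -/m; ring.
Qed.

(** Jensen for the square root: the variance of [Num.sqrt \o Z] is nonnegative. *)
Lemma mean_sqrt_le (V : finType) (Z : V -> R) : (0 < #|V|)%N ->
  (forall v, 0 <= Z v) -> mean (Num.sqrt \o Z) <= Num.sqrt (mean Z).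
Proof.
move=> V0 Z0; have m0 : 0 <= mean (Num.sqrt \o Z).
  by apply: mean_ge0 => v /=; rewrite sqrtr_ge0.
rewrite -[leLHS](ger0_norm m0) -sqrtr_sqr ler_sqrt; last exact: mean_ge0.
rewrite -subr_ge0 -[mean Z](@eq_mean _ (fun v => (Num.sqrt \o Z) v ^+ 2)); last first.
  by move=> v; rewrite /= sqr_sqrtr.
by rewrite -mean_sqr_sub//; apply: mean_ge0 => v; rewrite sqr_ge0.
Qed.

(** The uniform law on functions is a product law: expanding a product of sums gives a sum over
    functions. *)
Lemma mean_ffun_prod (S U : finType) (F : S -> U -> R) :
  mean (fun v : {ffun S -> U} => \prod_s F s (v s)) = \prod_s mean (F s).
Proof.
rewrite /mean big_split/= bigA_distr_bigA; congr (_ * _).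
by rewrite prodr_const exprVn card_ffun natrX.
Qed.

Lemma mean_ffun1 (S U : finType) (s : S) (p : U -> R) : (0 < #|U|)%N ->
  mean (fun v : {ffun S -> U} => p (v s)) = mean p.
Proof.
move=> U0; pose F s' u : R := if s' == s then p u else 1.
have dF G : \prod_s' (if s' == s then G s' else 1 : R) = G s.
  by rewrite -big_mkcond big_pred1_eq.
rewrite (eq_mean (G := fun v : {ffun S -> U} => \prod_s' F s' (v s'))); last by move=> v; rewrite dF.
rewrite mean_ffun_prod (eq_bigr (fun s' => if s' == s then mean p else 1)).
  by rewrite (dF (fun _ => mean p)).
by move=> s' _; rewrite /F; case: eqP => // _; rewrite mean_cst.
Qed.

(** Distinct coordinates are uncorrelated: take a product over all of [S] whose factors are 1 away
    from [s] and [t]. *)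
Lemma mean_ffun2 (S U : finType) (s t : S) (p q : U -> R) : (0 < #|U|)%N ->
  s != t ->
  mean (fun v : {ffun S -> U} => p (v s) * q (v t)) = mean p * mean q.
Proof.
move=> U0 st.
pose F s' u : R := (if s' == s then p u else 1) * (if s' == t then q u else 1).
have dF r G : \prod_s' (if s' == r then G s' else 1 : R) = G r.
  by rewrite -big_mkcond big_pred1_eq.
rewrite (eq_mean (G := fun v : {ffun S -> U} => \prod_s' F s' (v s'))); last first.
  by move=> v; rewrite /F big_split !dF.
rewrite mean_ffun_prod.
rewrite (eq_bigr (fun s' => (if s' == s then mean p else 1) *
                             (if s' == t then mean q else 1))).
  by rewrite big_split (dF _ s (fun=> mean p)) (dF _ t (fun=> mean q)).
move=> s' _; rewrite /F; case: (eqVneq s' s) => [->|_].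
  by rewrite (negPf st) mulr1; apply: eq_mean => u; rewrite mulr1.
rewrite mul1r; case: eqP => _; first by apply: eq_mean => u; rewrite mul1r.
by under eq_mean do rewrite mulr1; rewrite mean_cst.
Qed.

(** Expand the square of the centred average: injectivity of [i] makes different draws distinct
    coordinates, so the cross terms vanish, and the [n] diagonal terms each equal the variance. *)
Lemma mean_sample_sqr (S U : finType) (n : nat) (i : 'I_n -> S) (p : U -> R) :
  (0 < n)%N -> (0 < #|U|)%N -> injective i ->
  mean (fun v : {ffun S -> U} =>
          (n%:R^-1 * (\sum_k p (v (i k))) - mean p) ^+ 2) =
  n%:R^-1 * (mean (fun u => p u ^+ 2) - mean p ^+ 2).
Proof.
move=> n0 U0 inji; pose q u := p u - mean p.
have nn0 : n%:R != 0 :> R by rewrite pnatr_eq0 -lt0n.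
have mq : mean q = 0.
  by rewrite /q meanD mean_cst// subrr.
rewrite -mean_sqr_sub// -/q.
rewrite (eq_mean (G := fun v : {ffun S -> U} => n%:R^-1 ^+ 2 * \sum_k \sum_l q (v (i k)) * q (v (i l)))).
  rewrite meanZ mean_sum.
  rewrite (eq_bigr (fun=> mean (fun u => q u ^+ 2))).
    by rewrite sumr_const card_ord -[mean _ *+ n]mulr_natl expr2 -!mulrA mulKf.
  move=> k _; rewrite mean_sum (bigD1 k)//= big1 ?addr0.
    by rewrite (mean_ffun1 _ (fun u => q u * q u)).
  move=> l lk; rewrite mean_ffun2 ?mq ?mul0r//.
  by rewrite (inj_eq inji) eq_sym.
move=> v; under [in RHS]eq_bigr do rewrite -mulr_sumr.
rewrite -mulr_suml -expr2 -exprMn; congr (_ ^+ 2).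
rewrite /q sumrB sumr_const card_ord mulrBr; congr (_ - _).
by rewrite -[mean _ *+ n]mulr_natl mulKf.
Qed.

End Mean.

(** * From the probability space to the finite set of sampling outcomes *)

Section Sampling.
Context (R : realType) (d : measure_display) (T : measurableType d).
Variable P : probability T R.

(** [F \o W] is a finite combination of indicators of the fibres of [W], each fibre having
    probability [c]. *)
Lemma expectation_discrete (V : finType) (W : T -> V) (F : V -> R) (c : R) :
  (forall v, measurable (W @^-1` [set v])) ->
  (forall v, P (W @^-1` [set v]) = c%:E) ->
  ('E_P[F \o W] = (c * \sum_v F v)%:E)%E.
Proof.
move=> mW Wc; have mI v : P.-integrable setT (fun w => (\1_(W @^-1` [set v]) w)%:E).
  exact: integrable_indic.
rewrite unlock.
rewrite (eq_integral (fun w => \sum_v ((F v)%:E * (\1_(W @^-1` [set v]) w)%:E))%E).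
  rewrite integral_sum//; last by move=> v; exact: integrableZl.
  rewrite mulr_sumr -sumEFin; apply: eq_bigr => v _.
  rewrite integralZl// integral_indic// setIT mulrC EFinM; congr (_ * _)%E.
  exact: Wc.
move=> w _; rewrite (bigD1 (W w))//= big1 ?adde0.
  by rewrite indicE mem_set// mule1.
by move=> v vW; rewrite indicE memNset ?mule0//= => /esym/eqP; rewrite (negPf vW).
Qed.

(** A fibre of the joint outcome is an intersection of one event per draw, so independence gives it
    the same probability as every other fibre. *)
Lemma expectation_sampling (S U : finType) (X : S -> T -> U) (F : {ffun S -> U} -> R) :
  (forall s, discrete_rv (X s)) -> (forall s, uniform_rv P (X s)) ->
  mutually_independent P X ->
  ('E_P[fun w => F [ffun s => X s w]] = (mean F)%:E)%E.
Proof.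
move=> Xm Xu Xi; pose W w := [ffun s => X s w].
have WE v : W @^-1` [set v] = \bigcap_(s in [set` [set: S]%SET]) (X s @^-1` [set v s]).
  apply/seteqP; split=> w /=; first by move=> <- s _ /=; rewrite ffunE.
  by move=> H; apply/ffunP => s; rewrite ffunE; apply: H; rewrite /= inE.
rewrite /mean; apply: (@expectation_discrete _ W F).
  move=> v; rewrite WE; apply: fin_bigcap_measurable => // s _; exact: Xm.
move=> v; rewrite WE Xi.
under eq_bigr do rewrite Xu.
by rewrite prodEFin prodr_const cardsT exprVn card_ffun natrX.
Qed.

(** Each outcome has positive probability, so its event is nonempty. This turns an assumption on
    every realization into one on every choice of indices. *)
Lemma sampling_realized (S U : finType) (X : S -> T -> U) (v : {ffun S -> U}) :
  (0 < #|U|)%N -> (forall s, uniform_rv P (X s)) -> mutually_independent P X ->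
  exists w, forall s, X s w = v s.
Proof.
move=> U0 Xu Xi.
have := Xi [set: S]%SET (fun s => [set v s]).
under [in RHS]eq_bigr do rewrite Xu.
rewrite prodEFin prodr_const cardsT => PE.
have [w Hw] : \bigcap_(s in [set` [set: S]%SET]) (X s @^-1` [set v s]) !=set0.
  apply/set0P/eqP => E0; move: PE; rewrite E0 measure0 => -[/esym/eqP].
  by rewrite expf_eq0 invr_eq0 pnatr_eq0 -[_ == _]negbK -lt0n U0 andbF.
by exists w => s; apply: Hw; rewrite /= inE.
Qed.

End Sampling.

(** * Euclidean, Frobenius and spectral norms; inverses of coercive matrices *)

Section Norms.
Variable R : realType.

Lemma cauchy_schwarz (E : finType) (a b : E -> R) :
  (\sum_e a e * b e) ^+ 2 <= (\sum_e a e ^+ 2) * \sum_e b e ^+ 2.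
Proof.
set A := \sum_e a e ^+ 2; set C := \sum_e b e ^+ 2; set D := \sum_e a e * b e.
have : 0 <= \sum_i \sum_j (a i * b j - a j * b i) ^+ 2.
  by apply: sumr_ge0 => i _; apply: sumr_ge0 => j _; rewrite sqr_ge0.
(* Lagrange's identity: the double sum equals [2 * (A * C - D ^+ 2)]. *)
rewrite (eq_bigr (fun i => a i ^+ 2 * C + A * b i ^+ 2 - 2 * (a i * b i * D))).
  by rewrite sumrB big_split/= -!mulr_suml -!mulr_sumr -mulr_suml -/A -/C -/D; lra.
move=> i _; rewrite [_ * C]mulr_sumr [A * _]mulr_suml [_ * D]mulr_sumr [2 * _]mulr_sumr.
rewrite -big_split -sumrB/=.
by apply: eq_bigr => j _; ring.
Qed.

Lemma norm2_ge0 p (x : 'cV[R]_p) : 0 <= norm2 x.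
Proof. exact: sqrtr_ge0. Qed.

Lemma norm2_sqr p (x : 'cV[R]_p) : norm2 x ^+ 2 = \sum_i x i ord0 ^+ 2.
Proof. by rewrite sqr_sqrtr// sumr_ge0// => i _; rewrite sqr_ge0. Qed.

Lemma norm2_dot p (x y : 'cV[R]_p) : (x^T *m y) ord0 ord0 <= norm2 x * norm2 y.
Proof.
apply: (@le_trans _ _ `|(x^T *m y) ord0 ord0|); first exact: ler_norm.
rewrite -ler_sqr ?nnegrE ?mulr_ge0 ?norm2_ge0// real_normK ?num_real//.
rewrite exprMn !norm2_sqr mxE; under eq_bigr do rewrite mxE.
exact: cauchy_schwarz.
Qed.

Lemma norm2_tr p (x : 'cV[R]_p) : (x^T *m x) ord0 ord0 = norm2 x ^+ 2.
Proof. by rewrite mxE norm2_sqr; apply: eq_bigr => i _; rewrite mxE expr2. Qed.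

Lemma ler_norm2D p (x y : 'cV[R]_p) : norm2 (x + y) <= norm2 x + norm2 y.
Proof.
rewrite -ler_sqr ?nnegrE ?addr_ge0 ?norm2_ge0//.
have -> : norm2 (x + y) ^+ 2
    = norm2 x ^+ 2 + norm2 y ^+ 2 + 2 * (x^T *m y) ord0 ord0.
  rewrite mxE !norm2_sqr mulr_sumr -!big_split; apply: eq_bigr => i _.
  by rewrite !mxE/=; ring.
by have := norm2_dot x y; lra.
Qed.

Lemma norm2N p (x : 'cV[R]_p) : norm2 (- x) = norm2 x.
Proof. by rewrite /norm2; under eq_bigr do rewrite mxE sqrrN. Qed.

Lemma norm2_col_mx p q (x : 'cV[R]_p) (y : 'cV[R]_q) :
  norm2 (col_mx x y) ^+ 2 = norm2 x ^+ 2 + norm2 y ^+ 2.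
Proof.
rewrite !norm2_sqr big_split_ord/=.
by congr (_ + _); apply: eq_bigr => i _; rewrite ?col_mxEu ?col_mxEd.
Qed.

Definition frob2 p q (M : 'M[R]_(p, q)) : R := \sum_i \sum_j M i j ^+ 2.

Definition frob p q (M : 'M[R]_(p, q)) : R := Num.sqrt (frob2 M).

Lemma frob2_ge0 p q (M : 'M[R]_(p, q)) : 0 <= frob2 M.
Proof. by apply: sumr_ge0 => i _; apply: sumr_ge0 => j _; rewrite sqr_ge0. Qed.

Lemma frob_ge0 p q (M : 'M[R]_(p, q)) : 0 <= frob M.
Proof. exact: sqrtr_ge0. Qed.

Lemma frob_tr p q (M : 'M[R]_(p, q)) : frob M^T = frob M.
Proof.
rewrite /frob /frob2 exchange_big; congr (Num.sqrt _).
by apply: eq_bigr => i _; apply: eq_bigr => j _; rewrite mxE.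
Qed.

Lemma norm2_mulmx p q (M : 'M[R]_(p, q)) (x : 'cV[R]_q) :
  norm2 (M *m x) <= frob M * norm2 x.
Proof.
rewrite -ler_sqr ?nnegrE ?mulr_ge0 ?norm2_ge0 ?frob_ge0//.
rewrite exprMn [frob M ^+ 2]sqr_sqrtr ?frob2_ge0// !norm2_sqr mulr_suml.
by apply: ler_sum => i _; rewrite mxE; exact: cauchy_schwarz.
Qed.

Lemma spectral_norm_le p q (M : 'M[R]_(p, q)) (c : R) : 0 <= c ->
  (forall x, norm2 (M *m x) <= c * norm2 x) -> spectral_norm M <= c.
Proof.
move=> c0 Mc; apply: ge_sup.
  (* The zero vector shows that the set under the supremum is nonempty. *)
  exists (norm2 (M *m 0)), 0 => //=.
  by rewrite /norm2 big1 ?sqrtr0 ?ler01// => i _; rewrite mxE expr0n.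
move=> _ [x /= x1 <-]; apply: le_trans (Mc x) _.
by rewrite -[leRHS]mulr1 ler_wpM2l.
Qed.

(** The two blocks read and write orthogonal components, so squared norms add and a common bound on
    the blocks survives without any factor. *)
Lemma spectral_norm_offdiag_le p q (M : 'M[R]_(p, q)) (M' : 'M[R]_(q, p)) (c : R) :
  0 <= c -> (forall x, norm2 (M *m x) <= c * norm2 x) ->
  (forall x, norm2 (M' *m x) <= c * norm2 x) ->
  spectral_norm (block_mx 0 M M' 0) <= c.
Proof.
move=> c0 Mc Mc'; apply: spectral_norm_le => // x.
rewrite -ler_sqr ?nnegrE ?mulr_ge0 ?norm2_ge0// -[x]vsubmxK.
rewrite mul_block_col !mul0mx add0r addr0 exprMn !norm2_col_mx mulrDr addrC -!exprMn.
by apply: lerD; rewrite ler_sqr ?nnegrE ?mulr_ge0 ?norm2_ge0.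
Qed.

(** The quadratic-form content of M - cI being positive semidefinite, in a form that can be averaged
    over examples. *)
Definition coercive p (c : R) (M : 'M[R]_p) : Prop :=
  forall x : 'cV[R]_p, c * norm2 x ^+ 2 <= (x^T *m M *m x) ord0 ord0.

Lemma psd_coercive p (c : R) (M : 'M[R]_p) : psd (M - c%:M) -> coercive c M.
Proof.
move=> [_ H] x; have := H x.
rewrite mulmxBr mulmxBl mul_mx_scalar -scalemxAl.
by rewrite [leRHS]mxE [X in _ + X]mxE [X in _ - X]mxE norm2_tr subr_ge0.
Qed.

(** Bound the quadratic form by Cauchy-Schwarz, then cancel one factor [norm2 x]. *)
Lemma coercive_norm2 p (c : R) (M : 'M[R]_p) (x : 'cV[R]_p) :
  coercive c M -> c * norm2 x <= norm2 (M *m x).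
Proof.
move=> cM; have [x0|x0] := eqVneq (norm2 x) 0.
  by rewrite x0 mulr0 norm2_ge0.
have xp : 0 < norm2 x by rewrite lt_def x0 norm2_ge0.
rewrite -(ler_pM2r xp) -mulrA -expr2 [leRHS]mulrC.
by apply: le_trans (cM x) _; rewrite -mulmxA norm2_dot.
Qed.

Lemma norm2_eq0 p (x : 'cV[R]_p) : norm2 x = 0 -> x = 0.
Proof.
move=> /(congr1 (fun t => t ^+ 2)); rewrite norm2_sqr expr0n/= => /eqP.
rewrite psumr_eq0 => [/allP x0|i _]; last by rewrite sqr_ge0.
apply/matrixP => i j; rewrite ord1 mxE.
by have := x0 i (mem_index_enum i); rewrite /= sqrf_eq0 => /eqP.
Qed.

Lemma coercive_unitmx p (c : R) (M : 'M[R]_p) :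
  0 < c -> coercive c M -> M \in unitmx.
Proof.
(* [kermx] is a left kernel of rows; transposing makes it the kernel of [M] acting on columns, which
   coercivity forces to be zero. *)
move=> c0 cM; rewrite -unitmx_tr -row_free_unit -kermx_eq0.
apply/eqP/row_matrixP => i; rewrite row0.
have : row i (kermx M^T) *m M^T = 0 by apply/sub_kermxP; rewrite row_sub.
set u := row i _ => /(congr1 trmx); rewrite trmx_mul trmxK trmx0 => Mu.
apply: trmx_inj; rewrite trmx0; apply: norm2_eq0.
apply/eqP; rewrite eq_le norm2_ge0 andbT -(pmulr_rle0 _ c0).
apply: le_trans (coercive_norm2 _ cM) _; rewrite Mu.
by rewrite /norm2 big1 ?sqrtr0// => j _; rewrite mxE expr0n.
Qed.

Lemma coercive_invmx p (c : R) (M : 'M[R]_p) (x : 'cV[R]_p) :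
  0 < c -> coercive c M -> norm2 (invmx M *m x) <= c^-1 * norm2 x.
Proof.
move=> c0 cM; rewrite -ler_pdivrMl ?invr_gt0// invrK.
apply: le_trans (coercive_norm2 _ cM) _.
by rewrite mulmxA mulmxV ?mul1mx// (coercive_unitmx c0 cM).
Qed.

(** Factoring out the inverse of [S'] leaves the inverse of [S] applied to [C] only, so a bound on
    the unperturbed [C] suffices; two inverses meet [S' - S], whence the square of [c]. *)
Lemma invmx_mul_perturb p q (c K : R) (S S' : 'M[R]_p) (C C' : 'M[R]_(p, q))
    (x : 'cV[R]_q) :
  0 < c -> coercive c S -> coercive c S' -> frob C <= K ->
  norm2 ((invmx S' *m C' - invmx S *m C) *m x) <=
  (c^-1 * frob (C' - C) + K / c ^+ 2 * frob (S' - S)) * norm2 x.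
Proof.
move=> c0 cS cS' CK; have uS := coercive_unitmx c0 cS.
have uS' := coercive_unitmx c0 cS'.
have -> : (invmx S' *m C' - invmx S *m C) *m x =
    invmx S' *m ((C' - C) *m x - (S' - S) *m (invmx S *m (C *m x))).
  have -> : invmx S' *m C' - invmx S *m C
      = invmx S' *m (C' - C - (S' - S) *m (invmx S *m C)).
    by rewrite [(S' - S) *m _]mulmxBl mulKVmx// opprB addrA subrK mulmxBr mulKmx.
  by rewrite -mulmxA mulmxBl !mulmxA.
apply: le_trans (coercive_invmx _ c0 cS') _.
have ci : 0 <= c^-1 by rewrite invr_ge0 ltW.
rewrite mulrDl -!mulrA expr2.
have -> : c^-1 * (frob (C' - C) * norm2 x)
    + K * ((c * c)^-1 * (frob (S' - S) * norm2 x))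
  = c^-1 * (frob (C' - C) * norm2 x + frob (S' - S) * (c^-1 * (K * norm2 x))).
  by field; rewrite gt_eqF.
apply: ler_wpM2l => //; apply: le_trans (ler_norm2D _ _) _; rewrite norm2N.
apply: lerD; first exact: norm2_mulmx.
apply: le_trans (norm2_mulmx _ _) _; apply: ler_wpM2l; first exact: frob_ge0.
apply: le_trans (coercive_invmx _ c0 cS) _; apply: ler_wpM2l => //.
by apply: le_trans (norm2_mulmx _ _) _; rewrite ler_wpM2r ?norm2_ge0.
Qed.

End Norms.

(** * Covariance matrices and the mean square error of their estimates *)

Section Covariance.
Variable R : realType.

Lemma cross_covE (m p q : nat) (u : 'I_m -> 'cV[R]_p) (v : 'I_m -> 'cV[R]_q) i j :
  cross_cov u v i j = mean (fun k => u k i ord0 * v k j ord0).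
Proof.
rewrite /mean card_ord !mxE summxE; congr (_ * _); apply: eq_bigr => k _.
by rewrite mxE big_ord1 mxE.
Qed.

Lemma cross_cov_tr (m p q : nat) (u : 'I_m -> 'cV[R]_p) (v : 'I_m -> 'cV[R]_q) :
  (cross_cov u v)^T = cross_cov v u.
Proof.
apply/matrixP => i j; rewrite mxE !cross_covE.
by apply: eq_mean => k; rewrite mulrC.
Qed.

Lemma reg_covB (m m' p : nat) (u : 'I_m -> 'cV[R]_p) (u' : 'I_m' -> 'cV[R]_p) r :
  reg_cov u r - reg_cov u' r = cross_cov u u - cross_cov u' u'.
Proof. by rewrite /reg_cov opprD addrACA subrr addr0. Qed.

Lemma reg_cov_quad (m p : nat) (u : 'I_m -> 'cV[R]_p) (r : R) (x : 'cV[R]_p) :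
  (x^T *m reg_cov u r *m x) ord0 ord0 =
  mean (fun k => (x^T *m u k) ord0 ord0 ^+ 2) + r * norm2 x ^+ 2.
Proof.
rewrite mulmxDr mulmxDl mul_mx_scalar -scalemxAl mxE [X in _ + X]mxE norm2_tr.
congr (_ + _); rewrite -scalemxAr -scalemxAl mxE /mean card_ord; congr (_ * _).
rewrite mulmx_sumr mulmx_suml summxE; apply: eq_bigr => k _.
rewrite [x^T *m (_ *m _)]mulmxA -mulmxA mxE big_ord1 expr2; congr (_ * _).
by rewrite -[(u k)^T *m x]trmxK mxE trmx_mul trmxK.
Qed.

(* A realization in which every draw is the [k]-th example bounds the [k]-th
   summand of the full-sample matrix. *)
Lemma coercive_reg_cov (m n p : nat) (u : 'I_m -> 'cV[R]_p) (r c : R) :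
  (0 < m)%N -> (0 < n)%N ->
  (forall k, coercive c (reg_cov (fun _ : 'I_n => u k) r)) ->
  coercive c (reg_cov u r).
Proof.
move=> m0 n0 H x; rewrite reg_cov_quad -lerBlDr.
rewrite -[leLHS](@mean_cst R 'I_m _) ?card_ord//; apply: le_mean => k.
by have := H k x; rewrite reg_cov_quad mean_cst ?card_ord// lerBlDr.
Qed.

(** The squared Frobenius norm of a rank-one matrix is the product of the squared norms of its two
    vectors. *)
Lemma sum_mean_sqr (m p q : nat) (u : 'I_m -> 'cV[R]_p) (v : 'I_m -> 'cV[R]_q) :
  \sum_i \sum_j mean (fun k => (u k i ord0 * v k j ord0) ^+ 2) =
  mean (fun k => norm2 (u k) ^+ 2 * norm2 (v k) ^+ 2).
Proof.
rewrite [RHS](@eq_mean _ _ _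
    (fun k => \sum_i \sum_j (u k i ord0 * v k j ord0) ^+ 2)); last first.
  move=> k; rewrite !norm2_sqr mulr_suml; apply: eq_bigr => i _.
  by rewrite mulr_sumr; apply: eq_bigr => j _; rewrite exprMn.
by rewrite mean_sum; apply: eq_bigr => i _; rewrite mean_sum.
Qed.

Lemma mean_norm2_le (m p q : nat) (u : 'I_m -> 'cV[R]_p) (v : 'I_m -> 'cV[R]_q)
    (B : R) : (0 < m)%N ->
  (forall k, norm2 (u k) ^+ 2 <= B) -> (forall k, norm2 (v k) ^+ 2 <= B) ->
  mean (fun k => norm2 (u k) ^+ 2 * norm2 (v k) ^+ 2) <= B ^+ 2.
Proof.
move=> m0 uB vB; rewrite -[leRHS](@mean_cst R 'I_m _) ?card_ord//.
by apply: le_mean => k; rewrite [leRHS]expr2 ler_pM ?sqr_ge0.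
Qed.

(** Entry by entry, the square of a mean is at most the mean of the squares. *)
Lemma frob_cross_cov_le (m p q : nat) (u : 'I_m -> 'cV[R]_p)
    (v : 'I_m -> 'cV[R]_q) (B : R) : (0 < m)%N ->
  (forall k, norm2 (u k) ^+ 2 <= B) -> (forall k, norm2 (v k) ^+ 2 <= B) ->
  frob (cross_cov u v) <= B.
Proof.
move=> m0 uB vB; have B0 : 0 <= B.
  by apply: le_trans (uB (Ordinal m0)); rewrite sqr_ge0.
rewrite -[leRHS](ger0_norm B0) -sqrtr_sqr ler_sqrt ?sqr_ge0//.
apply: le_trans (mean_norm2_le m0 uB vB).
rewrite -sum_mean_sqr; apply: ler_sum => i _; apply: ler_sum => j _.
rewrite cross_covE -subr_ge0 -mean_sqr_sub ?card_ord//.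
by apply: mean_ge0 => k; rewrite sqr_ge0.
Qed.

(** The variance formula for a sample average, applied to each entry and summed. *)
Lemma mean_frob2_sample (S : finType) (m n p q : nat) (i : 'I_n -> S)
    (u : 'I_m -> 'cV[R]_p) (v : 'I_m -> 'cV[R]_q) :
  (0 < n)%N -> (0 < m)%N -> injective i ->
  mean (fun w : {ffun S -> 'I_m} =>
    frob2 (cross_cov (fun k => u (w (i k))) (fun k => v (w (i k)))
           - cross_cov u v)) =
  n%:R^-1 * (mean (fun k => norm2 (u k) ^+ 2 * norm2 (v k) ^+ 2)
             - frob2 (cross_cov u v)).
Proof.
move=> n0 m0 inji; rewrite -sum_mean_sqr /frob2 -sumrB mulr_sumr mean_sum.
apply: eq_bigr => a _; rewrite -sumrB mulr_sumr mean_sum; apply: eq_bigr => b _.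
rewrite cross_covE -(mean_sample_sqr _ n0 _ inji) ?card_ord//.
by apply: eq_mean => w; rewrite [X in X ^+ 2 = _]mxE [X in _ + X]mxE !cross_covE {1}/mean card_ord.
Qed.

Lemma mean_frob2_sample_le (S : finType) (m n p q : nat) (i : 'I_n -> S)
    (u : 'I_m -> 'cV[R]_p) (v : 'I_m -> 'cV[R]_q) (B : R) :
  (0 < n)%N -> (0 < m)%N -> injective i ->
  (forall k, norm2 (u k) ^+ 2 <= B) -> (forall k, norm2 (v k) ^+ 2 <= B) ->
  mean (fun w : {ffun S -> 'I_m} =>
    frob2 (cross_cov (fun k => u (w (i k))) (fun k => v (w (i k)))
           - cross_cov u v)) <= B ^+ 2 / n%:R.
Proof.
move=> n0 m0 inji uB vB; rewrite mean_frob2_sample// mulrC.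
rewrite ler_wpM2r ?invr_ge0 ?ler0n//.
apply: le_trans (mean_norm2_le m0 uB vB).
by rewrite lerBlDr lerDl frob2_ge0.
Qed.

(* In dimension one the summands lie in [0, B], whence a variance of at most
   B^2/4. *)
Lemma mean_frob2_sample_scalar_le (S : finType) (m n p : nat) (i : 'I_n -> S)
    (u : 'I_m -> 'cV[R]_p) (B : R) :
  p = 1%N -> (0 < n)%N -> (0 < m)%N -> injective i ->
  (forall k, norm2 (u k) ^+ 2 <= B) ->
  mean (fun w : {ffun S -> 'I_m} =>
    frob2 (cross_cov (fun k => u (w (i k))) (fun k => u (w (i k)))
           - cross_cov u u)) <= B ^+ 2 / 4 / n%:R.
Proof.
move=> p1; subst p => n0 m0 inji uB; rewrite mean_frob2_sample// mulrC.
rewrite ler_wpM2r ?invr_ge0 ?ler0n//.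
rewrite /frob2 !big_ord1 cross_covE; set y := mean (fun k => u k ord0 ord0 * _).
have : mean (fun k => norm2 (u k) ^+ 2 * norm2 (u k) ^+ 2) <= B * y.
  rewrite /y -meanZ; apply: le_mean => k.
  have -> : u k ord0 ord0 * u k ord0 ord0 = norm2 (u k) ^+ 2.
    by rewrite norm2_sqr big_ord1 expr2.
  by rewrite ler_wpM2r ?sqr_ge0.
(* The variance is at most B y - y^2 = B^2/4 - (y - B/2)^2. *)
have := sqr_ge0 (y - B / 2); rewrite !expr2; lra.
Qed.

End Covariance.

(** * Comparison with the Bernstein-type bound *)

Section Bound.
Variable R : realType.

(** From exp(-x) >= 1 - x at x = 5/32, exp(5/8) <= (32/27)^4, which is below 2. *)
Lemma ln2_ge : 5 / 8 <= ln 2 :> R.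
Proof.
rewrite -ler_expR lnK ?posrE ?ltr0n//.
have -> : 5 / 8 = 4%:R * (5 / 32) :> R by lra.
rewrite expRM_natl; have h : expR (5 / 32) <= 32 / 27 :> R.
  have := expR_ge1Dx (- (5 / 32 : R)); rewrite expRN => h.
  by rewrite -lef_pV2 ?posrE ?expR_gt0//; lra.
apply: (@le_trans _ _ ((32 / 27) ^+ 4)); last by rewrite !exprS expr0; lra.
by rewrite lerXn2r ?nnegrE ?expR_ge0//; lra.
Qed.

Lemma ln_nat_ge2 (D : nat) : (2 <= D)%N -> 5 / 8 <= ln D%:R :> R.
Proof.
move=> D2; apply: le_trans ln2_ge _.
by rewrite ler_ln ?posrE ?ltr0n ?ler_nat// (leq_trans _ D2).
Qed.

Lemma ln_nat_ge4 (D : nat) : (4 <= D)%N -> 5 / 4 <= ln D%:R :> R.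
Proof.
move=> D4; apply: (@le_trans _ _ (ln 4%:R)); last first.
  by rewrite ler_ln ?posrE ?ltr0n ?ler_nat// (leq_trans _ D4).
have -> : 4%:R = 2 * 2 :> R by lra.
by rewrite lnM ?posrE ?ltr0n//; have := ln2_ge; lra.
Qed.

(** The square-root term alone dominates; the linear term is nonnegative. The factor [v] records
    which multiple of B^2/n bounds the mean square error. *)
Lemma bernstein_bound_ge (B v : R) (n D : nat) : 0 <= B -> (0 < D)%N ->
  v <= 2 * ln D%:R -> Num.sqrt (v * B ^+ 2 / n%:R) <= bernstein_bound B n D.
Proof.
move=> B0 D0 vD; have lnD : 0 <= ln D%:R :> R by rewrite ln_ge0// ler1n.
have n0 : 0 <= n%:R^-1 :> R by rewrite invr_ge0 ler0n.
apply: (@le_trans _ _ (Num.sqrt (2 * B ^+ 2 * ln D%:R / n%:R))).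
  rewrite ler_sqrt; last by rewrite !mulr_ge0// sqr_ge0.
  by rewrite ler_wpM2r// [leRHS]mulrAC ler_wpM2r// sqr_ge0.
by rewrite lerDl !mulr_ge0// invr_ge0 mulr_ge0 ?ler0n.
Qed.

(** [X] and [Y] stand for the squared errors of the two diagonal blocks and [Z] for that of the
    cross block. [X] goes with the smaller constant [g]; exchanging the roles covers both
    orderings. *)
Lemma mean_error_le (V : finType) (F X Y Z : V -> R) (B g h : R) (n D p : nat) :
  (0 < #|V|)%N -> 0 <= B -> 0 < g -> g <= h -> (2 <= D)%N -> (0 < p)%N ->
  (forall v, 0 <= X v) -> (forall v, 0 <= Y v) -> (forall v, 0 <= Z v) ->
  mean X <= B ^+ 2 / n%:R -> (p = 1%N -> mean X <= B ^+ 2 / 4 / n%:R) ->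
  mean Y <= B ^+ 2 / n%:R -> mean Z <= B ^+ 2 / n%:R ->
  (forall v, F v <= Num.max
     (g^-1 * Num.sqrt (Z v) + B / g ^+ 2 * Num.sqrt (X v))
     (h^-1 * Num.sqrt (Z v) + B / h ^+ 2 * Num.sqrt (Y v))) ->
  mean F <= B / g ^+ 2 * bernstein_bound B n (2 * p)
            + g^-1 * bernstein_bound B n D.
Proof.
move=> V0 B0 g0 gh D2 p0 X0 Y0 Z0 mX mX1 mY mZ FM.
have h0 : 0 < h := lt_le_trans g0 gh.
have hg : h^-1 <= g^-1 by rewrite lef_pV2.
have gi0 : 0 <= g^-1 by rewrite invr_ge0 ltW.
have hi0 : 0 <= h^-1 by rewrite invr_ge0 ltW.
have a0 : 0 <= B / g ^+ 2 by rewrite mulr_ge0// invr_ge0 sqr_ge0.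
have ba : B / h ^+ 2 <= B / g ^+ 2.
  by rewrite ler_wpM2l// lef_pV2 ?posrE ?exprn_gt0// lerXn2r ?nnegrE// ltW.
(* One expression dominates both sides of the maximum, since [g <= h] and both [X v] and [Y v] are
   at most their sum. *)
apply: (@le_trans _ _ (mean (fun v => B / g ^+ 2 * Num.sqrt (X v + Y v)
                                      + g^-1 * Num.sqrt (Z v)))).
  apply: le_mean => v; apply: le_trans (FM v) _; rewrite ge_max; apply/andP; split.
    rewrite addrC lerD2r ler_wpM2l// ler_sqrt ?addr_ge0//.
    by rewrite lerDl.
  rewrite addrC; apply: lerD; last by rewrite ler_wpM2r ?sqrtr_ge0.
  apply: ler_pM; rewrite ?sqrtr_ge0 ?mulr_ge0 ?invr_ge0 ?sqr_ge0//.
  by rewrite ler_sqrt ?addr_ge0// lerDr.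
rewrite meanD !meanZ; apply: lerD; apply: ler_wpM2l => //.
  apply: le_trans (mean_sqrt_le V0 _) _; first by move=> v; exact: addr_ge0.
  (* For [p = 1] the constant is 1/4 + 1 = 5/4, at most 2 ln 2; for [p >= 2] it is 1 + 1 = 2, at
     most 2 ln 4. *)
  have [p1|p1] := eqVneq p 1%N.
    apply: le_trans (bernstein_bound_ge (v := 5 / 4) _ _ _ _) => //; last 2 first.
    - by rewrite muln_gt0 p0.
    - by rewrite p1; have := @ln_nat_ge2 (2 * 1) isT; lra.
    rewrite ler_sqrt; last by rewrite !mulr_ge0 ?invr_ge0 ?ler0n ?sqr_ge0.
    by rewrite meanD; have := mX1 p1; lra.
  apply: le_trans (bernstein_bound_ge (v := 2) _ _ _ _) => //; last 2 first.
  - by rewrite muln_gt0 p0.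
  - have /ln_nat_ge4 : (4 <= 2 * p)%N.
      by rewrite (leq_pmul2l (m := 2) (n1 := 2))// ltn_neqAle eq_sym p1.
    lra.
  rewrite ler_sqrt; last by rewrite !mulr_ge0 ?invr_ge0 ?ler0n ?sqr_ge0.
  by rewrite meanD; lra.
apply: le_trans (mean_sqrt_le V0 Z0) _.
apply: le_trans (bernstein_bound_ge (v := 1) _ _ _ _) => //; last 2 first.
- exact: ltnW.
- by have := ln_nat_ge2 D2; lra.
by rewrite mul1r ler_sqrt// mulr_ge0 ?invr_ge0 ?ler0n ?sqr_ge0.
Qed.

End Bound.

(** * Deterministic error of the block matrices, and the expected error *)

Lemma spectral_norm_perturb_le (R : realType) (p q : nat) (Sxx Sxx' : 'M[R]_p)
    (Syy Syy' : 'M[R]_q) (Sxy Sxy' : 'M[R]_(p, q)) (B gx gy : R) :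
  0 < gx -> 0 < gy -> coercive gx Sxx -> coercive gx Sxx' ->
  coercive gy Syy -> coercive gy Syy' -> frob Sxy <= B ->
  spectral_norm (invmx (diag_block Sxx' Syy') *m offdiag_block Sxy'
                 - invmx (diag_block Sxx Syy) *m offdiag_block Sxy) <=
  Num.max (gx^-1 * frob (Sxy' - Sxy) + B / gx ^+ 2 * frob (Sxx' - Sxx))
          (gy^-1 * frob (Sxy' - Sxy) + B / gy ^+ 2 * frob (Syy' - Syy)).
Proof.
move=> gx0 gy0 cx cx' cy cy' SB.
(* The block-diagonal inverse acts blockwise, so both products, and hence their difference, are
   block off-diagonal. *)
have prodE (U : 'M[R]_p) (V : 'M[R]_q) (W : 'M[R]_(p, q)) :
    coercive gx U -> coercive gy V ->
    invmx (diag_block U V) *m offdiag_block W =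
    block_mx 0 (invmx U *m W) (invmx V *m W^T) 0.
  move=> cU cV; have uB : block_mx U 0 0 V \in unitmx.
    rewrite unitmxE det_ublock unitrM -!unitmxE.
    by rewrite (coercive_unitmx gx0 cU) (coercive_unitmx gy0 cV).
  rewrite /diag_block invmx_block_diag// /offdiag_block mulmx_block.
  by rewrite !mulmx0 !mul0mx !addr0 !add0r.
rewrite !prodE// opp_block_mx add_block_mx !subr0.
have B0 : 0 <= B := le_trans (frob_ge0 _) SB.
apply: spectral_norm_offdiag_le => [|x|x].
- by rewrite le_max addr_ge0// mulr_ge0 ?frob_ge0 ?invr_ge0 ?mulr_ge0// ?invr_ge0 ?sqr_ge0 ?ltW.
- apply: le_trans (invmx_mul_perturb _ _ gx0 cx cx' SB) _.
  by rewrite ler_wpM2r ?norm2_ge0// le_max lexx.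
have SBT : frob Sxy^T <= B by rewrite frob_tr.
apply: le_trans (invmx_mul_perturb _ _ gy0 cy cy' SBT) _.
by rewrite -linearB/= frob_tr ler_wpM2r ?norm2_ge0// le_max lexx orbT.
Qed.

Theorem theorem1 (R : realType) (N n dx dy : nat)
    (hN : (0 < N)%N) (hn : (0 < n)%N) (hdx : (0 < dx)%N) (hdy : (0 < dy)%N)
    (rx ry : R) (hrx : 0 < rx) (hry : 0 < ry)
    (f : 'I_N -> 'cV[R]_dx) (g : 'I_N -> 'cV[R]_dy)
    (d : measure_display) (T : measurableType d) (P : probability T R)
    (I J K : 'I_n -> T -> 'I_N)
    (A1 : uniform_sampling P I J K)
    (B : R)
    (A2 : forall i : 'I_N, Num.max (norm2 (f i) ^+ 2) (norm2 (g i) ^+ 2) <= B)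
    (gx gy : R) (hgx : 0 < gx) (hgy : 0 < gy) :
  let hSxx (w : T) := reg_cov (fun k => f (I k w)) rx in
  let hSyy (w : T) := reg_cov (fun k => g (J k w)) ry in
  let hSxy (w : T) := cross_cov (fun k => f (K k w)) (fun k => g (K k w)) in
  let A := diag_block (reg_cov f rx) (reg_cov g ry) in
  let BB := offdiag_block (cross_cov f g) in
  let hA (w : T) := diag_block (hSxx w) (hSyy w) in
  let hB (w : T) := offdiag_block (hSxy w) in
  let e1 := B / gx ^+ 2 * bernstein_bound B n (2 * dx)
            + gx^-1 * bernstein_bound B n (dx + dy) in
  let e2 := B / gy ^+ 2 * bernstein_bound B n (2 * dy)
            + gy^-1 * bernstein_bound B n (dx + dy) in
  (forall w : T, psd (hSxx w - gx%:M)) ->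
  (forall w : T, psd (hSyy w - gy%:M)) ->
  ('E_P[fun w => spectral_norm (invmx (hA w) *m hB w - invmx A *m BB)]
   <= (Num.max e1 e2)%:E)%E.
Proof.
move=> hSxx hSyy hSxy A BB hA hB e1 e2 Hx Hy; case: A1 => Xm Xu Xi.
have fB k : norm2 (f k) ^+ 2 <= B by have := A2 k; rewrite ge_max => /andP[].
have gB k : norm2 (g k) ^+ 2 <= B by have := A2 k; rewrite ge_max => /andP[].
have B0 : 0 <= B by apply: le_trans (fB (Ordinal hN)); rewrite sqr_ge0.
(* An outcome of all 3n draws is one function; [ix], [iy] and [ixy] select the draws of each
   estimate. *)
pose V := {ffun 'I_n + 'I_n + 'I_n -> 'I_N}.
have N0 : (0 < #|'I_N|)%N by rewrite card_ord.
have V0 : (0 < #|V|)%N by rewrite card_ffun expn_gt0 N0.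
pose ix (k : 'I_n) : 'I_n + 'I_n + 'I_n := inl (inl k).
pose iy (k : 'I_n) : 'I_n + 'I_n + 'I_n := inl (inr k).
pose ixy (k : 'I_n) : 'I_n + 'I_n + 'I_n := inr k.
have ix_inj : injective ix by move=> k l [].
have iy_inj : injective iy by move=> k l [].
have ixy_inj : injective ixy by move=> k l [].
pose Sx (v : V) := reg_cov (fun k => f (v (ix k))) rx.
pose Sy (v : V) := reg_cov (fun k => g (v (iy k))) ry.
pose Sxy (v : V) := cross_cov (fun k => f (v (ixy k))) (fun k => g (v (ixy k))).
have cx v : coercive gx (Sx v).
  have [w wv] := sampling_realized v N0 Xu Xi.
  have := psd_coercive (Hx w); rewrite /hSxx /Sx.
  by under eq_fun do rewrite -[I _ w]/(all_indices I J K (ix _) w) wv.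
have cy v : coercive gy (Sy v).
  have [w wv] := sampling_realized v N0 Xu Xi.
  have := psd_coercive (Hy w); rewrite /hSyy /Sy.
  by under eq_fun do rewrite -[J _ w]/(all_indices I J K (iy _) w) wv.
(* The full-sample bound comes from the constant outcomes, in which every draw is example [k]. *)
have cfx : coercive gx (reg_cov f rx).
  apply: (coercive_reg_cov hN hn) => k; have := cx [ffun=> k].
  by rewrite /Sx; under eq_fun do rewrite ffunE.
have cfy : coercive gy (reg_cov g ry).
  apply: (coercive_reg_cov hN hn) => k; have := cy [ffun=> k].
  by rewrite /Sy; under eq_fun do rewrite ffunE.
pose F (v : V) := spectral_norm
  (invmx (diag_block (Sx v) (Sy v)) *m offdiag_block (Sxy v) - invmx A *m BB).
(* The integrand depends on [w] only through the drawn indices, so its expectation is a finite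
   mean. *)
have -> : (fun w => spectral_norm (invmx (hA w) *m hB w - invmx A *m BB)) =
    (fun w => F [ffun s => all_indices I J K s w]).
  apply/funext => w; rewrite /F.
  set v := finfun _; have vE t : v t = all_indices I J K t w by rewrite ffunE.
  have SxE : Sx v = hSxx w.
    by rewrite /Sx; under eq_fun do rewrite vE.
  have SyE : Sy v = hSyy w.
    by rewrite /Sy; under eq_fun do rewrite vE.
  have SxyE : Sxy v = hSxy w.
    rewrite /Sxy; under eq_fun do rewrite vE.
    by under [X in cross_cov _ X]eq_fun do rewrite vE.
  by rewrite SxE SyE SxyE.
rewrite (expectation_sampling _ Xm Xu Xi) lee_fin.
pose X v := frob2 (Sx v - reg_cov f rx).
pose Y v := frob2 (Sy v - reg_cov g ry).
pose Z v := frob2 (Sxy v - cross_cov f g).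
have X0 v : 0 <= X v by exact: frob2_ge0.
have Y0 v : 0 <= Y v by exact: frob2_ge0.
have Z0 v : 0 <= Z v by exact: frob2_ge0.
have mX : mean X <= B ^+ 2 / n%:R.
  under eq_mean do rewrite /X reg_covB; exact: mean_frob2_sample_le.
have mY : mean Y <= B ^+ 2 / n%:R.
  under eq_mean do rewrite /Y reg_covB; exact: mean_frob2_sample_le.
have mZ : mean Z <= B ^+ 2 / n%:R by exact: mean_frob2_sample_le.
have mX1 : dx = 1%N -> mean X <= B ^+ 2 / 4 / n%:R.
  move=> dx1; under eq_mean do rewrite /X reg_covB.
  exact: mean_frob2_sample_scalar_le.
have mY1 : dy = 1%N -> mean Y <= B ^+ 2 / 4 / n%:R.
  move=> dy1; under eq_mean do rewrite /Y reg_covB.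
  exact: mean_frob2_sample_scalar_le.
have FM v : F v <= Num.max
    (gx^-1 * Num.sqrt (Z v) + B / gx ^+ 2 * Num.sqrt (X v))
    (gy^-1 * Num.sqrt (Z v) + B / gy ^+ 2 * Num.sqrt (Y v)).
  by apply: spectral_norm_perturb_le => //; exact: frob_cross_cov_le.
have D2 : (2 <= dx + dy)%N by exact: (leq_add hdx hdy).
(* The smaller of [gx] and [gy] decides which of [e1] and [e2] bounds the mean. *)
rewrite le_max; case: (leP gx gy) => [gxy|/ltW gyx]; apply/orP.
  by left; apply: (mean_error_le V0 B0 hgx gxy D2 hdx X0 Y0 Z0).
right; apply: (mean_error_le V0 B0 hgy gyx D2 hdy Y0 X0 Z0) => // v.
by rewrite maxC.
Qed.
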